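(* Assume $n\ge3$. Let $M$ be an $n$-compartment cycle model with input and output in the same compartment and no other inputs or outputs (i.e. $In=Out=\{q\}$ for some compartment $q$). Then $M$ is generically locally identifiable if and only if $|Leak|\le 1$.
   Context: A linear compartmental model $(G,In,Out,Leak)$ consists of a directed graph $G=(V,E)$ with $V=\{1,\dots,n\}$ (vertices are called compartments) and subsets $In,Out,Leak\subseteq V$. Each edge $j\to i$ has a parameter $k_{ij}$, and each $j\in Leak$ has a parameter $k_{0j}$. The compartmental matrix $A$ is the $n\times n$ matrix with off-diagonal entries $A_{ij}=k_{ij}$ if $j\to i\in E$ and $0$ otherwise, and diagonal entries $A_{ii}=-\sum_{p:\,i\to p\in E}k_{pi}$ if $i\notin Leak$, $A_{ii}=-k_{0i}-\sum_{p:\,i\to p\in E}k_{pi}$ if $i\in Leak$. Let $\partial I$ be the $n\times n$ diagonal matrix with all diagonal entries the differential operator $d/dt$, and let $(B)_{ji}$ denote $B$ with row $j$ and column $i$ removed. The input-output equations are, for $i\in Out$, $$\det(\partial I-A)\,y_i=\sum_{j\in In}(-1)^{i+j}\det\big((\partial I-A)_{ji}\big)\,u_j ,$$ with both sides expanded in powers of $d/dt$ (i.e., in derivatives of the $y_i$ and $u_j$). The coefficient map $c:\mathbb{R}^{|E|+|Leak|}\to\mathbb{R}^m$ sends the vector of parameters to the vector of all non-monic coefficients of these equations (coefficients identically equal to $1$ are omitted, as are coefficients identically $0$). A strongly connected model with at least one input is generically locally identifiable if, outside a set of measure zero, every point of $\mathbb{R}^{|E|+|Leak|}$ has an open neighborhood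 $U$ such that $c|_U$ is one-to-one. An $n$-compartment cycle model is a linear compartmental model whose graph $G$ is the directed cycle with edges $1\to2\to3\to\cdots\to n\to1$ (parameters $k_{21},k_{32},\dots,k_{n,n-1},k_{1n}$). *)

(* Defs.v *)
(* Built on MathComp and MathComp-Analysis. *)
From HB Require Import structures.
From mathcomp Require Import all_boot all_order all_algebra.
From mathcomp Require Import all_classical all_reals all_analysis.

Set Implicit Arguments.
Unset Strict Implicit.
Unset Printing Implicit Defensive.

Import Order.TTheory GRing.Theory Num.Theory.
Import numFieldNormedType.Exports.

Local Open Scope classical_set_scope.
Local Open Scope ring_scope.

(* Compartments are numbered from 0; the pair (j, i) in [edges M] is the
   directed edge j -> i. *)
Record compartmental_model (n : nat) := CompartmentalModel {
  edges : {set 'I_n * 'I_n};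
  inputs : {set 'I_n};
  outputs : {set 'I_n};
  leaks : {set 'I_n};
  edges_irreflexive : forall i : 'I_n, (i, i) \notin edges
}.

Section Model.
Variables (R : realType) (n : nat) (M : compartmental_model n).

(* R^(|E| + |Leak|): the edge parameters come first, in the order of
   [enum (edges M)], followed by the leak parameters. *)
Definition params : Type := 'rV[R]_(#|edges M| + #|leaks M|).

(* k_ij, extended by 0 when j -> i is not an edge *)
Definition edge_param (k : params) (i j : 'I_n) : R :=
  match boolP ((j, i) \in edges M) with
  | AltTrue h => k 0 (lshift #|leaks M| (enum_rank_in h (j, i)))
  | AltFalse _ => 0
  end.

(* k_0j, extended by 0 when j has no leak *)
Definition leak_param (k : params) (j : 'I_n) : R :=
  match boolP (j \in leaks M) with
  | AltTrue h => k 0 (rshift #|edges M| (enum_rank_in h j))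
  | AltFalse _ => 0
  end.

Definition compartmental_matrix (k : params) : 'M[R]_n :=
  \matrix_(i, j)
    if i == j then
      - leak_param k i - \sum_(p | (i, p) \in edges M) edge_param k p i
    else edge_param k i j.

(* With 'X standing for d/dt, [char_poly_mx A] is the matrix (d/dt) I - A.
   The input-output equation of i reads
     ioeq_lhs k * y_i = \sum_(j in inputs M) ioeq_rhs k i j * u_j;
   [cofactor B j i] is (-1)^(j+i) times the determinant of B with row j and
   column i removed. *)
Definition ioeq_lhs (k : params) : {poly R} :=
  \det (char_poly_mx (compartmental_matrix k)).

Definition ioeq_rhs (k : params) (i j : 'I_n) : {poly R} :=
  cofactor (char_poly_mx (compartmental_matrix k)) j i.

(* In the equation of output i, (i, None, d) designates the coefficient of
   the d-th derivative of y_i and (i, Some j, d) that of the d-th derivative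
   of u_j.  No derivative of order larger than n occurs. *)
Definition coef_pos : finType := ('I_n * option 'I_n * 'I_n.+1)%type.

Definition ioeq_coef (x : coef_pos) (k : params) : R :=
  let: (i, side, d) := x in
  if side is Some j then (ioeq_rhs k i j)`_d else (ioeq_lhs k)`_d.

Definition nontrivial_coefs : {set coef_pos} :=
  [set x : coef_pos |
    [&& x.1.1 \in outputs M,
        (if x.1.2 is Some j then j \in inputs M else true),
        ~~ `[< forall k, ioeq_coef x k = 0 >] &
        ~~ `[< forall k, ioeq_coef x k = 1 >]]]%SET.

Definition coef_map (k : params) : 'rV[R]_#|nontrivial_coefs| :=
  \row_r ioeq_coef (enum_val r) k.

End Model.

(* Lebesgue null sets of R^m: coverable by countably many boxes (indexed by
   D) of arbitrarily small total volume.  D lets the family be finite or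
   empty, so that the empty set is null also when m = 0. *)
Definition lebesgue_null (R : realType) (m : nat) (N : set 'rV[R]_m) : Prop :=
  forall eps : R, 0 < eps ->
  exists (D : set nat) (a b : nat -> 'rV[R]_m),
    [/\ forall r i, D r -> a r 0 i <= b r 0 i,
        N `<=` \bigcup_(r in D) [set x | forall i, a r 0 i <= x 0 i <= b r 0 i]
      & (\esum_(r in D) (\prod_(i < m) (b r 0 i - a r 0 i))%:E <= eps%:E)%E].

(* Meant for strongly connected models with at least one input. *)
Definition generically_locally_identifiable (R : realType) (n : nat)
    (M : compartmental_model n) : Prop :=
  exists2 N : set (params R M), lebesgue_null N &
    forall k : params R M, ~ N k ->
      exists U : set 'rV[R]_(#|edges M| + #|leaks M|),
        [/\ open U, U k & set_inj U (@coef_map R n M)].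

(* [ordS i] is i + 1 modulo n. *)
Definition cycle_model (n : nat) (M : compartmental_model n) : Prop :=
  edges M = [set (i, ordS i) | i : 'I_n]%SET.

(* Main.v *)
Require Import Defs.
From mathcomp Require Import all_boot all_order all_algebra.
From mathcomp Require Import all_classical all_reals all_analysis.
From mathcomp Require Import measurable_realfun zify ring lra.

(** Let e_i be the parameter of the edge i -> i + 1 and a_i the total rate at
    which compartment i loses material, e_i plus the leak of i if there is one.
    For a cycle, the matrix X - A has the polynomials X + a_i on the diagonal
    and the constants - e_i on a single cyclic off-diagonal, so the left-hand
    side of the input-output equation is prod_i (X + a_i) - prod_i e_i and the
    right-hand side is prod_(i <> q) (X + a_i) ([ioeq_lhs_cycle],
    [ioeq_rhs_cycle]).  The coefficients therefore carry exactly the multiset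
    of the a_i with i <> q, the number a_q and the product of the e_i: n + 1
    quantities.

    With at most one leak, e_i = a_i for every i without leak, and the
    remaining e_i is recovered from the product as soon as the others are
    nonzero.  The only ambiguity is the order of the a_i, which disappears in a
    small neighbourhood of a point where they are pairwise distinct
    ([generic_locally_injective]).  The excluded points lie on finitely many
    hyperplanes, which are null because a bounded piece of a hyperplane is
    covered by the boxes of a fine grid ([null_hyperplane],
    [null_not_generic]).

    With two leaks, at s and t, the pair (e_s, e_t) can be moved along a level
    curve of the product while the two leaks compensate, keeping a_s and a_t.
    Hence the coefficient map is injective near no point at all
    ([not_locally_injective]), and the exceptional set would have to be the
    whole space.  That is not a null set: integrating over slices shows that
    boxes covering the unit cube have total volume at least 1
    ([cover_unit_cube_volume]). *)

Set Implicit Arguments.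
Unset Strict Implicit.
Unset Printing Implicit Defensive.

Import Order.TTheory GRing.Theory Num.Theory.
Import numFieldNormedType.Exports.

Local Open Scope classical_set_scope.
Local Open Scope ring_scope.

(** * Determinant and diagonal cofactors of a cyclic matrix *)

Definition cyclic_mx (R : comNzRingType) (n : nat) (d c : 'I_n -> R) : 'M[R]_n :=
  \matrix_(i, j) (if i == j then d i else if i == ordS j then c j else 0).

Lemma eq_ordSE n (i j : 'I_n) :
  (i == ordS j) = ((i == j.+1 :> nat) || (j.+1 == n) && (i == 0%N :> nat)).
Proof.
rewrite -val_eqE /=; case: (eqVneq j.+1 n) => [->|ne].
  by rewrite modnn (ltn_eqF (ltn_ord i)).
by rewrite modn_small ?orbF // ltn_neqAle ne ltn_ord.
Qed.

(** Expanding along the first row leaves only the entries in the first and the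
    last column, and both minors are triangular, one with the d_i and the other
    with the c_i on the diagonal.  For n = 1 the two diagonals would collide. *)
Lemma det_cyclic_mx (R : comNzRingType) (n : nat) (d c : 'I_n -> R) :
  (1 < n)%N ->
  \det (cyclic_mx d c) = \prod_i d i + (-1) ^+ n.-1 * \prod_i c i.
Proof.
case: n d c => [|[|n]] // d c _.
rewrite (expand_det_row _ ord0) (bigD1 ord0) //= (bigD1 ord_max) //=.
rewrite big1 ?addr0; last first.
  move=> j /andP[j0 jmax]; rewrite mxE eq_sym (negbTE j0).
  have jn := ltn_ord j.
  rewrite eq_ordSE; do ! case: eqP => ? //; rewrite ?mul0r //.
  by case/negP: jmax; apply/eqP/val_inj => /=; lia.
rewrite /cofactor /= addn0 add0n expr0 mul1r.
rewrite [X in X * _ + _]mxE eqxx [X in _ + X * _]mxE.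
rewrite eq_ordSE -val_eqE /= !eqxx.
rewrite (@det_trig _ _ (row' _ (col' ord0 _))); last first.
  apply/is_trig_mxP => /= i j ij; rewrite !mxE eq_ordSE -val_eqE /= /bump /=.
  have jn := ltn_ord j.
  do ! case: eqP => ? //; exfalso; lia.
rewrite -[\det (row' _ (col' ord_max _))]det_tr.
rewrite (@det_trig _ _ (trmx _)); last first.
  apply/is_trig_mxP => /= i j ij; rewrite !mxE eq_ordSE -val_eqE lift_max /= /bump /=.
  have jn := ltn_ord j.
  do ! case: eqP => ? //; exfalso; lia.
rewrite [X in _ + X]mulrCA; congr (_ + _); last congr (_ * _).
  rewrite [RHS]big_ord_recl; congr (_ * _); apply: eq_bigr => i _.
  by rewrite !mxE eqxx.
rewrite [RHS]big_ord_recr mulrC; congr (_ * _); apply: eq_bigr => i _.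
have -> : widen_ord (leqnSn n.+1) i = lift ord_max i.
  by apply: val_inj => /=; rewrite /bump leqNgt ltn_ord.
have max_i : lift ord_max i = i :> nat by rewrite /= /bump leqNgt ltn_ord.
rewrite !mxE eq_ordSE -val_eqE /= -/(nat_of_ord (lift ord_max i)).
by rewrite /= in max_i *; rewrite max_i /bump /= add1n eqxx (gtn_eqF (ltnSn i)).
Qed.

(** The determinant is affine in the entry (q, q), with the cofactor as slope;
    comparing the determinants for d_q and d_q + 1 gives the slope without
    describing the minor, which is not triangular for a general q. *)
Lemma cofactor_cyclic_mx (R : comNzRingType) (n : nat) (d c : 'I_n -> R)
    (q : 'I_n) :
  (1 < n)%N ->
  cofactor (cyclic_mx d c) q q = \prod_(i | i != q) d i.
Proof.
move=> n1; pose d' i := if i == q then d i + 1 else d i.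
have cof j : cofactor (cyclic_mx d' c) q j = cofactor (cyclic_mx d c) q j.
  rewrite /cofactor; congr (_ * \det _); apply/matrixP => i k.
  by rewrite !mxE /d' [lift q i == q]eq_sym (negbTE (neq_lift _ _)).
have := det_cyclic_mx d' c n1; rewrite (expand_det_row _ q) (bigD1 q) //=.
have := det_cyclic_mx d c n1; rewrite (expand_det_row _ q) (bigD1 q) //=.
rewrite [\prod_i d i](bigD1 q) // [\prod_i d' i](bigD1 q) //=.
rewrite ![cyclic_mx _ _ q q]mxE eqxx.
have -> : d' q = d q + 1 by rewrite /d' eqxx.
have -> : \prod_(i | i != q) d' i = \prod_(i | i != q) d i.
  by apply: eq_bigr => i /negbTE iq; rewrite /d' iq.
have -> : \sum_(i | i != q) cyclic_mx d' c q i * cofactor (cyclic_mx d' c) q i =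
          \sum_(i | i != q) cyclic_mx d c q i * cofactor (cyclic_mx d c) q i.
  apply: eq_bigr => i iq; rewrite cof; congr (_ * _).
  by rewrite !mxE eq_sym (negbTE iq).
rewrite cof !mulrDl !mul1r => e.
by rewrite addrAC e [_ + _ + _ in RHS]addrAC => /addrI.
Qed.

(** * The whole space is not null *)

(** Induction on the dimension: for each value t of the last coordinate, the
    boxes whose last side contains t cover the slice at t, so the volumes of
    their projections sum to at least 1; integrating this inequality over t
    turns the indicator of each last side into at most its length.
    Corners and points are sequences, of which the first m terms count, so that
    no casts between dimensions are needed. *)
Lemma cover_unit_cube_volume (R : realType) (m : nat) (D : set nat)
    (a b : nat -> nat -> R) :
  (forall r i, D r -> a r i <= b r i) ->
  (forall x : nat -> R, (forall i, 0 <= x i <= 1) ->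
    exists2 r, D r & forall i, (i < m)%N -> a r i <= x i <= b r i) ->
  (1 <= \esum_(r in D) (\prod_(i < m) (b r i - a r i))%:E)%E.
Proof.
elim: m D => [|m IHm] D ab cover.
  have [r Dr _] := cover (fun=> 0) (fun=> (introT andP (conj (lexx _) ler01))).
  apply: esum_ge; exists [set r]; first by split=> // _ ->.
  by rewrite fsbig_set1 big_ord0.
pose vol r : R := \prod_(i < m) (b r i - a r i).
have vol_ge0 r : D r -> 0 <= vol r.
  by move=> Dr; apply: prodr_ge0 => i _; rewrite subr_ge0 ab.
pose slice r : set R := `[a r m, b r m]%classic.
pose w r : R := if r \in D then vol r else 0.
have w_ge0 r : 0 <= w r.
  by rewrite /w; case: ifPn => // /set_mem; exact: vol_ge0.
have slice_cover (t : R) : `[0, 1]%classic t ->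
    (1 <= \sum_(0 <= r <oo) (w r * \1_(slice r) t)%:E)%E.
  rewrite /= in_itv /= => t01.
  pose Dt := D `&` [set r | slice r t].
  have -> : (\sum_(0 <= r <oo) (w r * \1_(slice r) t)%:E =
             \esum_(r in Dt) (vol r)%:E)%E.
    rewrite nneseries_esumT; last by move=> r; rewrite lee_fin mulr_ge0.
    rewrite (esum_mkcond Dt); apply: eq_esum => r _.
    rewrite /w in_setI indicE; case: (r \in D) => /=; rewrite ?mul0r //.
    have -> : (r \in [set r | slice r t]) = (t \in slice r).
      by apply/idP/idP => /set_mem ?; apply/mem_set.
    by case: ifP; rewrite ?mulr1 ?mulr0.
  apply: IHm => [r i [Dr _]|x x01]; first exact: ab.
  have [i|r Dr box] := cover (fun i => if i == m then t else x i).
    by case: eqP.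
  exists r => [|i im].
    by split=> //; have := box m (ltnSn m); rewrite eqxx /slice /= in_itv.
  by have := box i (ltnW im); rewrite (ltn_eqF im).
pose mu := @lebesgue_measure R.
pose I : set (measurableTypeR R) := `[0, 1]%classic.
have mI : measurable I by exact: measurable_itv.
have -> : (1 = \int[mu]_(t in I) cst 1%E t)%E.
  rewrite integral_cst // mul1e; apply/esym/(etrans (lebesgue_measure_itv `[0, 1])).
  by rewrite /= lte01 sube0.
have mw r : measurable_fun I
    ((fun t => (w r * \1_(slice r) t)%:E) : measurableTypeR R -> \bar R).
  apply/measurable_EFinP; apply: measurable_funM => //.
  apply: measurable_indic; exact: measurable_itv.
apply: (@le_trans _ _ (\int[mu]_(t in I)
    \sum_(0 <= r <oo) (w r * \1_(slice r) t)%:E)%E).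
  apply: ge0_le_integral => //.
  by apply: ge0_emeasurable_sum => // r t _ _; rewrite lee_fin mulr_ge0.
rewrite integral_nneseries //; last by move=> r t _; rewrite lee_fin mulr_ge0.
rewrite nneseries_esumT; last first.
  by move=> r; apply: integral_ge0 => t _; rewrite lee_fin mulr_ge0.
rewrite [leRHS]esum_mkcond; apply: le_esum => r _.
have /= -> := @integralZl_indic _ _ _ mu I mI (fun=> slice r) (w r) _ _; last 2 first.
- by move=> /lt_geF; rewrite w_ge0.
- exact: measurable_itv.
rewrite integral_indic //; last exact: measurable_itv.
rewrite /w; case: ifPn => [/set_mem Dr|_]; last by rewrite mul0e.
rewrite big_ord_recr /= EFinM; apply: lee_pmul => //.
- by rewrite lee_fin vol_ge0.
- apply: (@le_trans _ _ (mu (slice r))).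
    apply: le_measure; last exact: subIsetl.
      by apply/mem_set/measurableI => //; exact: measurable_itv.
    by apply/mem_set; exact: measurable_itv.
  have := lebesgue_measure_itv `[a r m, b r m].
  rewrite -[lebesgue_measure _]/(mu (slice r)) => ->.
  by case: ifP => //= _; rewrite lee_fin subr_ge0 ab.
Qed.

Lemma not_null_setT (R : realType) (m : nat) : ~ lebesgue_null [set: 'rV[R]_m].
Proof.
move=> /(_ 2^-1 ltac:(by rewrite invr_gt0)) [D [a [b [ab cover vol]]]].
pose ext (u : 'rV[R]_m) (i : nat) : R :=
  if insub i is Some j then u 0 j else 0.
have extE u (i : 'I_m) : ext u i = u 0 i.
  by rewrite /ext valK.
suff : (1 <= \esum_(r in D) (\prod_(i < m) (b r 0 i - a r 0 i))%:E)%E.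
  by move=> /le_trans/(_ vol); rewrite lee_fin; lra.
have -> : \esum_(r in D) (\prod_(i < m) (b r 0 i - a r 0 i))%:E =
          \esum_(r in D) (\prod_(i < m) (ext (b r) i - ext (a r) i))%:E.
  by apply: eq_esum => r _; congr EFin; apply: eq_bigr => i _; rewrite !extE.
apply: (@cover_unit_cube_volume R m D (ext \o a) (ext \o b)) => [r i Dr|x x01].
  by rewrite /= /ext; case: insubP => // j _ _; exact: ab.
have [r Dr box] := cover (\row_i x i) I; exists r => // i im.
by have := box (Ordinal im); rewrite mxE -!extE.
Qed.

(** * Hyperplanes are null *)

Section NullSets.
Variables (R : realType) (m : nat).
Implicit Types (N : set 'rV[R]_m).

Definition box (a b : 'rV[R]_m) : set 'rV[R]_m :=
  [set x | forall i, a 0 i <= x 0 i <= b 0 i].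

Definition box_volume (a b : 'rV[R]_m) : R := \prod_(i < m) (b 0 i - a 0 i).

Lemma null_countable_cover N :
  (forall eps : R, 0 < eps ->
    exists (T : countType) (D : set T) (a b : T -> 'rV[R]_m),
      [/\ forall t i, D t -> a t 0 i <= b t 0 i,
          N `<=` \bigcup_(t in D) box (a t) (b t)
        & (\esum_(t in D) (box_volume (a t) (b t))%:E <= eps%:E)%E]) ->
  lebesgue_null N.
Proof.
move=> cover eps /cover[T [D [a [b [ab ND vol]]]]].
pose lift_index (u : T -> 'rV[R]_m) r := oapp u 0 (unpickle r).
have lift_indexE u t : lift_index u (pickle t) = u t.
  by rewrite /lift_index pickleK.
exists (pickle @` D), (lift_index a), (lift_index b); split.
- by move=> _ i [t Dt <-]; rewrite !lift_indexE; exact: ab.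
- move=> x /ND[t Dt xt]; exists (pickle t); first by exists t.
  by rewrite /= !lift_indexE.
rewrite (@reindex_esum _ _ _ D _ pickle); last first.
  by apply: inj_bij => s t _ _; exact: (pcan_inj pickleK).
by under eq_esum do rewrite !lift_indexE.
Qed.

Lemma null_finite_cover N :
  (forall eps : R, 0 < eps ->
    exists (T : finType) (a b : T -> 'rV[R]_m),
      [/\ forall t i, a t 0 i <= b t 0 i,
          N `<=` \bigcup_t box (a t) (b t)
        & \sum_t box_volume (a t) (b t) <= eps]) ->
  lebesgue_null N.
Proof.
move=> cover; apply: null_countable_cover => eps /cover[T [a [b [ab NT vol]]]].
exists T, setT, a, b; split=> //.
have -> : [set: T] = [set` enum T].
  by apply/seteqP; split=> t // _; rewrite /= mem_enum.
rewrite esum_fset //; last first.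
  by move=> t _; rewrite lee_fin prodr_ge0 // => i _; rewrite subr_ge0 ab.
by rewrite -fsbig_seq ?enum_uniq // big_enum /= sumEFin lee_fin.
Qed.

(** The cover of the set of index t is given the budget eps / 2 ^ (t + 1). *)
Lemma null_bigcup (T : countType) (F : T -> set 'rV[R]_m) :
  (forall t, lebesgue_null (F t)) -> lebesgue_null (\bigcup_t F t).
Proof.
move=> nullF; apply: null_countable_cover => eps eps0.
pose eps_ (t : T) : R := eps / (2 ^ (pickle t).+1)%:R.
have eps_gt0 t : 0 < eps_ t by rewrite divr_gt0 // ltr0n expn_gt0.
have [D DP] := choice (fun t => nullF t _ (eps_gt0 t)).
have [a aP] := choice DP.
have [b bP] := choice aP.
exists (T * nat)%type, [set p | D p.1 p.2], (fun p => a p.1 p.2), (fun p => b p.1 p.2).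
split.
- by move=> [t r] i /= Dr; have [+ _ _] := bP t; apply.
- move=> x [t _ xt]; have [_ /(_ _ xt)[r Dr xr] _] := bP t.
  by exists (t, r).
have -> : [set p | D p.1 p.2] = [set: T] `*`` D.
  by apply/seteqP; split=> -[t r] //= [].
rewrite -(@esum_esum _ _ _ _ _ (fun t r => (box_volume (a t r) (b t r))%:E)); last first.
  move=> t r _ Dr; rewrite lee_fin prodr_ge0 // => i _.
  by rewrite subr_ge0; have [+ _ _] := bP t; apply.
apply: (@le_trans _ _ (\esum_(t in [set: T]) (eps_ t)%:E)).
  by apply: le_esum => t _; have [] := bP t.
rewrite -(@reindex_esum _ _ _ setT (pickle @` [set: T]) pickle
  (fun r => (eps / (2 ^ r.+1)%:R)%:E)); last first.
  by apply: inj_bij => s t _ _; exact: (pcan_inj pickleK).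
apply: le_trans (epsilon_trick0 xpredT (ltW eps0)).
have pow_ge0 r : (0 <= (eps / (2 ^ r.+1)%:R)%:E)%E.
  by rewrite lee_fin divr_ge0 // ltW.
rewrite nneseries_esumT // esum_mkcond; apply: le_esum => r _.
by case: ifP.
Qed.

End NullSets.

Lemma scalar_rowE (R : realType) (m : nat) (f : 'rV[R]_m -> R) :
  scalar f -> forall x, f x = \sum_i x 0 i * f 'e_i.
Proof.
move=> lin_f x.
have f0 : f 0 = 0.
  by have := lin_f (-1) 0 0; rewrite scaler0 addr0 mulN1r addNr.
have fD : {morph f : u v / u + v}.
  by move=> u v; have := lin_f 1 u v; rewrite scale1r mul1r.
rewrite {1}(row_sum_delta x) (big_morph f fD f0); apply: eq_bigr => i _.
by have := lin_f (x 0 i) 'e_i 0; rewrite f0 !addr0.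
Qed.

(** On the hyperplane, coordinate c is a linear function of the other ones, with
    Lipschitz constant L.  Cut the range of the others into K + 1 intervals of
    length h: above each cell of the grid the hyperplane stays within L * h of
    its height at the corner of the cell.  The (K + 1) ^ (m - 1) boxes have
    total volume (2 B) ^ (m - 1) * 2 L h, which tends to 0 with h. *)
Lemma null_bounded_hyperplane (R : realType) (m : nat) (w : 'I_m -> R)
    (c : 'I_m) (B : R) :
  w c != 0 ->
  lebesgue_null [set x : 'rV[R]_m |
    \sum_i x 0 i * w i = 0 /\ forall i, `|x 0 i| < B].
Proof.
move=> wc0; apply: null_finite_cover => eps eps0.
have [B0|B0] := leP B 0.
  exists void, (fun=> 0), (fun=> 0); split.
  - by case.
  - by move=> x [_ /(_ c)]; rewrite ltNge (le_trans B0).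
  - by rewrite big1 ?ltW // => -[].
pose L := \sum_d `|w (lift c d) / w c|.
have L0 : 0 <= L by exact: sumr_ge0.
pose C := (2 * B) ^+ m.-1 * (2 * L * (2 * B)).
have C0 : 0 <= C by rewrite !mulr_ge0 ?exprn_ge0 // ?mulr_ge0 // ltW.
pose K := (Num.truncn (C / eps)).
pose h := 2 * B / K.+1%:R.
have h0 : 0 < h by rewrite !mulr_gt0 // invr_gt0 ltr0n.
pose t (z : {ffun 'I_m.-1 -> 'I_K.+1}) d := - B + h * (z d)%:R.
pose y z := - \sum_d t z d * (w (lift c d) / w c).
pose a z := \row_i if unlift c i is Some d then t z d else y z - L * h.
pose b z := \row_i if unlift c i is Some d then t z d + h else y z + L * h.
exists {ffun 'I_m.-1 -> 'I_K.+1}, a, b; split.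
- move=> z i; rewrite !mxE; case: unliftP => [d|] _; first by rewrite lerDl ltW.
  by rewrite lerD2l ge0_cp // mulr_ge0 // ltW.
- move=> x [fx xB].
  have pos d : 0 <= (x 0 (lift c d) + B) / h.
    rewrite divr_ge0 ?(ltW h0) //.
    by have := xB (lift c d); rewrite ltr_norml => /andP[+ _]; lra.
  (* the cell of the grid that contains the projection of x *)
  pose n d := Num.truncn ((x 0 (lift c d) + B) / h).
  have nK d : (n d < K.+1)%N.
    rewrite truncn_lt_nat // ltr_pdivrMr // /h mulrCA divff ?mulr1; last first.
      by rewrite pnatr_eq0.
    by have := xB (lift c d); rewrite ltr_norml => /andP[_]; lra.
  pose z : {ffun 'I_m.-1 -> 'I_K.+1} := [ffun d => inord (n d)].
  have tx d : t z d <= x 0 (lift c d) <= t z d + h.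
    have /andP[lo hi] := truncn_itv (pos d).
    rewrite /t ffunE inordK //; move: lo hi.
    rewrite -/(n d) ler_pdivlMr // ltr_pdivrMr // -natr1 mulrDl mul1r.
    rewrite [_ * h]mulrC => lo hi; apply/andP; split; lra.
  exists z => // i; rewrite !mxE; case: unliftP => [d -> //|->].
  rewrite -ler_distl.
  have -> : x 0 c = - \sum_d x 0 (lift c d) * (w (lift c d) / w c).
    move: fx; rewrite (bigD1_ord c) //= => /eqP; rewrite addr_eq0 => /eqP e.
    apply: (mulIf wc0); rewrite e mulNr mulr_suml; congr (- _).
    by apply: eq_bigr => d _; rewrite -mulrA divfK.
  rewrite /y -opprB normrN opprK addrC -sumrB mulr_suml.
  apply: le_trans (ler_norm_sum _ _ _) _; apply: ler_sum => d _.
  rewrite -mulrBl normrM mulrC ler_wpM2l //.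
  by have /andP[lo hi] := tx d; rewrite ler_norml; apply/andP; split; lra.
have -> : \sum_z box_volume (a z) (b z) = C / K.+1%:R.
  have vol z : box_volume (a z) (b z) = 2 * L * h * h ^+ m.-1.
    rewrite /box_volume (bigD1_ord c) //= !mxE unlift_none; congr (_ * _).
      by lra.
    rewrite -[in RHS](card_ord m.-1) -prodr_const; apply: eq_bigr => d _.
    by rewrite !mxE liftK addrC addKr.
  under eq_bigr do rewrite vol.
  rewrite sumr_const card_ffun !card_ord -[LHS]mulr_natr natrX.
  have hK : h * K.+1%:R = 2 * B by rewrite /h divfK // pnatr_eq0.
  rewrite -[LHS]mulrA -exprMn hK mulrC /C /h; ring.
rewrite ler_pdivrMr ?ltr0n // mulrC -ler_pdivrMr //.
by apply/ltW; have /andP[] := truncn_itv (divr_ge0 C0 (ltW eps0)).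
Qed.

Lemma null_hyperplane (R : realType) (m : nat) (f : 'rV[R]_m -> R)
    (v : 'rV[R]_m) :
  scalar f -> f v != 0 -> lebesgue_null [set x | f x = 0].
Proof.
move=> lin_f fv0.
have [c fc0] : exists c, f 'e_c != 0.
  apply/existsP; apply: contraNT fv0; rewrite negb_exists => /forallP f0.
  rewrite scalar_rowE // big1 // => i _.
  by move: (f0 i); rewrite negbK => /eqP ->; rewrite mulr0.
pose F (B : nat) := [set x : 'rV[R]_m |
  \sum_i x 0 i * f 'e_i = 0 /\ forall i, `|x 0 i| < B%:R].
have nullF : lebesgue_null (\bigcup_B F B).
  by apply: null_bigcup => B; exact: null_bounded_hyperplane fc0.
move=> eps /nullF[D [a [b [ab cover vol]]]]; exists D, a, b; split=> //.
apply: subset_trans cover => x /= fx.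
exists (Num.truncn (\sum_i `|x 0 i|)).+1 => //; split.
  by rewrite -scalar_rowE.
move=> i; apply: le_lt_trans (truncnS_gt _).
by rewrite (bigD1 i) //= lerDl sumr_ge0.
Qed.

(** * The input-output equation of a cycle model *)

Section CycleModel.
Variables (R : realType) (n : nat) (M : compartmental_model n) (q : 'I_n).
Hypotheses (n_ge3 : (3 <= n)%N) (cycleM : cycle_model M).
Hypotheses (inM : inputs M = [set q]%SET) (outM : outputs M = [set q]%SET).
Implicit Types (k : params R M) (i j : 'I_n).

Let n_gt1 : (1 < n)%N. Proof. exact: ltnW. Qed.

Definition flow k i : R := edge_param k (ordS i) i.

Definition outflow k i : R := flow k i + leak_param k i.

Lemma mem_cycle_edges i j : ((j, i) \in edges M) = (i == ordS j).
Proof.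
rewrite cycleM; apply/imsetP/eqP => [[l _ e]|eij].
  by case: e => -> ->.
by exists j; rewrite ?eij.
Qed.

Lemma edge_param_cycle k i j :
  edge_param k i j = if i == ordS j then flow k j else 0.
Proof.
case: eqP => [-> //|/eqP ne]; rewrite /edge_param.
case: {-}_ / boolP => // h; exfalso.
by move: h; rewrite mem_cycle_edges (negbTE ne).
Qed.

Lemma leak_param_notin k i : i \notin leaks M -> leak_param k i = 0.
Proof.
move=> iL; rewrite /leak_param; case: {-}_ / boolP => // h; exfalso.
by rewrite h in iL.
Qed.

Lemma char_poly_mx_cycle k :
  char_poly_mx (compartmental_matrix k) =
  cyclic_mx (fun i => 'X + (outflow k i)%:P) (fun i => - (flow k i)%:P).
Proof.
apply/matrixP => i j; rewrite !mxE; case: eqP => _.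
  rewrite mulr1n (eq_bigl (pred1 (ordS i))); last first.
    by move=> p; rewrite mem_cycle_edges.
  rewrite big_pred1_eq edge_param_cycle eqxx /outflow -opprD polyCN opprK.
  by rewrite [flow k i + _]addrC.
rewrite mulr0n add0r edge_param_cycle; case: ifP => //.
by rewrite polyC0 oppr0.
Qed.

Lemma ioeq_lhs_cycle k :
  ioeq_lhs k = \prod_i ('X + (outflow k i)%:P) - (\prod_i flow k i)%:P.
Proof.
rewrite /ioeq_lhs char_poly_mx_cycle det_cyclic_mx //; congr (_ + _).
rewrite prodrN card_ord mulrA -exprD rmorph_prod.
have -> : (n.-1 + n = (n.-1).*2.+1)%N by lia.
by rewrite exprS -mul2n exprM sqrrN !expr1n mulr1 mulN1r.
Qed.

Lemma ioeq_rhs_cycle k :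
  ioeq_rhs k q q = \prod_(i | i != q) ('X + (outflow k i)%:P).
Proof. by rewrite /ioeq_rhs char_poly_mx_cycle cofactor_cyclic_mx. Qed.

Lemma size_ioeq_rhs k : size (ioeq_rhs k q q) = n.
Proof.
rewrite ioeq_rhs_cycle -big_enum.
under eq_bigr do rewrite -[(outflow _ _)%:P]opprK -polyCN.
rewrite size_prod_XsubC -cardE cardC1 card_ord; lia.
Qed.

(** Omitting the coefficients that are constantly 0 or 1 loses nothing, and no
    coefficient lies beyond the degrees recorded by [coef_pos]. *)
Lemma eq_coef_mapP k1 k2 :
  Defs.coef_map k1 = Defs.coef_map k2 <->
  ioeq_lhs k1 = ioeq_lhs k2 /\ ioeq_rhs k1 q q = ioeq_rhs k2 q q.
Proof.
split=> [eq_map|[eq_lhs eq_rhs]].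
  have eq_coef (x : coef_pos n) : x.1.1 = q -> (if x.1.2 is Some j then j = q else True) ->
      ioeq_coef x k1 = ioeq_coef x k2.
    move=> xq xs; have [x_in|] := boolP (x \in nontrivial_coefs R M).
      have /matrixP/(_ 0 (enum_rank_in x_in x)) := eq_map.
      by rewrite !mxE enum_rankK_in.
    rewrite inE outM inM xq inE eqxx /=.
    have -> : (if x.1.2 is Some j then j \in [set q]%SET else true) = true.
      case: x.1.2 xs => [j ->|] //; exact: set11.
    by rewrite /= negb_and !negbK => /orP[] /asboolP const; rewrite !const.
  split; apply/polyP => d; have [dn|dn] := ltnP d n.+1.
  - by have := eq_coef (q, None, inord d) erefl I; rewrite /= inordK.
  - by rewrite nth_default ?size_char_poly // nth_default ?size_char_poly.
  - by have := eq_coef (q, Some q, inord d) erefl erefl; rewrite /= inordK.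
  - by rewrite nth_default ?size_ioeq_rhs 1?ltnW // nth_default ?size_ioeq_rhs 1?ltnW.
apply/rowP => r; rewrite !mxE; move: (enum_valP r).
case: (enum_val r) => [[i side] d].
rewrite inE outM inM /= inE => /and4P[/eqP -> + _ _].
case: side => [j /set1P ->|_] /=; first by rewrite eq_rhs.
by rewrite eq_lhs.
Qed.

Lemma flow_enum_val k r : flow k (enum_val r).1 = k 0 (lshift #|leaks M| r).
Proof.
have eE : ((enum_val r).1, ordS (enum_val r).1) = enum_val r.
  have := enum_valP r; case: (enum_val r) => j i /=.
  by rewrite mem_cycle_edges => /eqP ->.
rewrite /flow /edge_param; case: {-}_ / boolP => [h|/negP[]]; last first.
  by rewrite mem_cycle_edges.
congr (k 0 (lshift _ _)); apply: enum_val_inj.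
by rewrite enum_rankK_in.
Qed.

Lemma leak_param_enum_val k r :
  leak_param k (enum_val r) = k 0 (rshift #|edges M| r).
Proof.
rewrite /leak_param; case: {-}_ / boolP => [h|/negP[]]; last exact: enum_valP.
by rewrite enum_valK_in.
Qed.

Lemma eq_params k1 k2 :
  flow k1 =1 flow k2 -> leak_param k1 =1 leak_param k2 -> k1 = k2.
Proof.
move=> eq_flow eq_leak; apply/rowP => c; rewrite -[c]fintype.splitK.
case: (fintype.split c) => r /=.
  by rewrite -!flow_enum_val.
by rewrite -!leak_param_enum_val.
Qed.

Definition params_of (e l : 'I_n -> R) : params R M :=
  row_mx (\row_r e (enum_val r).1) (\row_r l (enum_val r)).

Lemma flow_params_of e l i : flow (params_of e l) i = e i.
Proof.
rewrite /flow /edge_param; case: {-}_ / boolP => [h|/negP[]].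
  by rewrite row_mxEl mxE enum_rankK_in.
by rewrite mem_cycle_edges.
Qed.

Lemma leak_params_of e l i :
  leak_param (params_of e l) i = if i \in leaks M then l i else 0.
Proof.
case: ifPn => [iL|]; last exact: leak_param_notin.
rewrite /leak_param; case: {-}_ / boolP => [h|/negP[]] //.
by rewrite row_mxEr mxE enum_rankK_in.
Qed.

Lemma scalar_flow i : scalar (flow ^~ i).
Proof.
move=> a u v; rewrite /flow /edge_param; case: {-}_ / boolP => h.
  by rewrite !mxE.
by rewrite mulr0 addr0.
Qed.

Lemma scalar_leak_param i : scalar ((@leak_param R n M) ^~ i).
Proof.
move=> a u v; rewrite /leak_param; case: {-}_ / boolP => h.
  by rewrite !mxE.
by rewrite mulr0 addr0.
Qed.

Lemma continuous_flow i : continuous (flow ^~ i).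
Proof.
rewrite /flow /edge_param; case: {-}_ / boolP => h.
  exact: coord_continuous.
exact: cst_continuous.
Qed.

Lemma continuous_outflow i : continuous (outflow ^~ i).
Proof.
move=> k; apply: (@cvgD _ _ _ (nbhs k) _ (flow ^~ i) ((@leak_param R n M) ^~ i)).
  exact: continuous_flow.
rewrite /leak_param; case: {-}_ / boolP => h; last exact: cvg_cst.
exact: coord_continuous.
Qed.

(** Evaluating the right-hand sides at - outflow k2 i shows that this number is
    also a root for k1; the separation hypothesis forces the root to be the one
    of the same index.  The left-hand sides then differ by
    (outflow k1 q - outflow k2 q) times a nonconstant polynomial, up to a
    constant, so both this factor and the constant vanish. *)
Lemma eq_outflow k1 k2 :
  (forall i j, i != q -> j != q -> i != j -> outflow k1 i != outflow k2 j) ->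
  Defs.coef_map k1 = Defs.coef_map k2 ->
  outflow k1 =1 outflow k2 /\ \prod_i flow k1 i = \prod_i flow k2 i.
Proof.
move=> sep /eq_coef_mapP[eq_lhs eq_rhs].
have eq_neq i : i != q -> outflow k1 i = outflow k2 i.
  move=> iq; have : (ioeq_rhs k1 q q).[- outflow k2 i] == 0.
    rewrite eq_rhs ioeq_rhs_cycle horner_prod (bigD1 i) //=.
    by rewrite hornerD hornerX hornerC addNr mul0r.
  rewrite ioeq_rhs_cycle horner_prod prodf_seq_eq0 => /hasP[j _ /andP[jq]].
  rewrite hornerD hornerX hornerC addrC subr_eq0 => /eqP e.
  have [ji|/(sep _ _ jq iq)] := eqVneq j i; first by rewrite -[in LHS]ji.
  by rewrite e eqxx.
have lhsE k : ioeq_lhs k =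
    ('X + (outflow k q)%:P) * ioeq_rhs k q q - (\prod_i flow k i)%:P.
  by rewrite ioeq_lhs_cycle ioeq_rhs_cycle (bigD1 q).
have eq_const : (outflow k1 q - outflow k2 q) *: ioeq_rhs k1 q q =
    (\prod_i flow k1 i - \prod_i flow k2 i)%:P.
  apply/eqP; rewrite -mul_polyC !polyCB -subr_eq0.
  move: eq_lhs => /eqP; rewrite !lhsE -eq_rhs -subr_eq0; congr (_ == 0).
  by ring.
have eq_q : outflow k1 q = outflow k2 q.
  apply/eqP; rewrite -subr_eq0; apply: contraTT n_gt1 => ne.
  rewrite -leqNgt -(size_ioeq_rhs k1) -(size_scale _ ne) eq_const.
  exact: size_polyC_leq1.
split; first by move=> i; case: (eqVneq i q) => [-> //|]; exact: eq_neq.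
apply/eqP; rewrite -subr_eq0 -polyC_eq0 -eq_const eq_q subrr.
by rewrite scale0r.
Qed.

(** * At most one leak: local injectivity at generic points *)

Definition generic k : Prop :=
  (forall i j, i != q -> j != q -> i != j -> outflow k i != outflow k j) /\
  (forall i, flow k i != 0).

Lemma null_not_generic : lebesgue_null [set k | ~ generic k].
Proof.
pose F (t : 'I_n * 'I_n + 'I_n) : set (params R M) :=
  match t with
  | inl (i, j) => if i != j then [set k | outflow k i - outflow k j = 0] else set0
  | inr i => [set k | flow k i = 0]
  end.
have nullF t : lebesgue_null (F t).
  case: t => [[i j]|i] /=.
    case: ifPn => [ij|_].
      apply: (@null_hyperplane _ _ (fun k => outflow k i - outflow k j)
        (params_of (fun l => (l == i)%:R) (fun=> 0))).
        move=> a u v; rewrite /outflow !scalar_flow !scalar_leak_param; ring.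
      rewrite /outflow !flow_params_of !leak_params_of !if_same eqxx.
      by rewrite [j == i]eq_sym (negbTE ij) !addr0 subr0 oner_neq0.
    move=> eps eps0; exists set0, (fun=> 0), (fun=> 0); split=> //.
    by rewrite esum_set0 lee_fin ltW.
  apply: (@null_hyperplane _ _ (flow ^~ i) (params_of (fun=> 1) (fun=> 0))).
    exact: scalar_flow.
  by rewrite flow_params_of oner_neq0.
move=> eps /(null_bigcup nullF)[D [a [b [ab cover vol]]]].
exists D, a, b; split=> //; apply: subset_trans cover => k /= ngen.
apply: contrapT => nF; apply: ngen; split=> [i j _ _ ij|i]; apply/eqP => e.
  by apply: nF; exists (inl (i, j)) => //=; rewrite ij /= e subrr.
by apply: nF; exists (inr i).
Qed.

(** Near k every outflow stays on its own side of the midpoint between any two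
    distinct outflows of k, so an outflow of one nearby point cannot equal that
    of another compartment, both different from q, at a second one. *)
Lemma generic_locally_injective k :
  (#|leaks M| <= 1)%N -> generic k ->
  exists U : set (params R M), [/\ open U, U k & set_inj U (@Defs.coef_map R n M)].
Proof.
move=> /card_le1_eqP leak1 [sep flow0].
pose mid i j := (outflow k i + outflow k j) / 2.
pose V : set 'rV[R]_(#|edges M| + #|leaks M|) := [set k' |
  (forall i, flow k' i != 0) /\
  (forall t : 'I_n * 'I_n, outflow k t.1 < outflow k t.2 ->
     outflow k' t.1 < mid t.1 t.2 /\ mid t.1 t.2 < outflow k' t.2)].
have Vk : nbhs k V.
  apply: filterI.
    apply: (@filter_forall _ _ (fun i k' => flow k' i != 0) (nbhs k)) => i.
    exact: (cvgr_neq0 _ (@continuous_flow i k) (flow0 i)).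
  apply: (@filter_forall _ _ (fun (t : 'I_n * 'I_n) k' =>
    outflow k t.1 < outflow k t.2 ->
    outflow k' t.1 < mid t.1 t.2 /\ mid t.1 t.2 < outflow k' t.2) (nbhs k)).
  move=> [i j] /=.
  have [lt_ij|_] := ltP (outflow k i) (outflow k j); last exact: nearW.
  have lt_mid : outflow k i < mid i j by rewrite /mid; lra.
  have mid_lt : mid i j < outflow k j by rewrite /mid; lra.
  have near_lt : nbhs k [set k' | outflow k' i < mid i j].
    exact: (cvgr_lt _ (@continuous_outflow i k) _ lt_mid).
  have near_gt : nbhs k [set k' | mid i j < outflow k' j].
    exact: (cvgr_gt _ (@continuous_outflow j k) _ mid_lt).
  by apply: filterS (filterI near_lt near_gt) => k' [].
exists V^°; split; [exact: open_interior | exact: Vk |].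
move=> k1 k2 /set_mem/interior_subset[flow1 lt1] /set_mem/interior_subset[_ lt2].
move=> eq_map.
have [|eq_out eq_prod] := eq_outflow _ eq_map.
  move=> i j iq jq ij; apply/eqP => e.
  have := sep i j iq jq ij; rewrite neq_lt => /orP[] lt_ij.
    have [+ _] := lt1 (i, j) lt_ij; have [_ +] := lt2 (i, j) lt_ij.
    by rewrite /= -e => /lt_trans/[apply]; rewrite ltxx.
  have [_ +] := lt1 (j, i) lt_ij; have [+ _] := lt2 (j, i) lt_ij.
  by rewrite /= -e => /lt_trans/[apply]; rewrite ltxx.
have eq_flow_notin i : i \notin leaks M -> flow k1 i = flow k2 i.
  move=> iL; have := eq_out i.
  by rewrite /outflow !leak_param_notin // !addr0.
have eq_flow : flow k1 =1 flow k2.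
  move=> i; have [iL|/eq_flow_notin //] := boolP (i \in leaks M).
  (* i is the only leak, so all other factors of the product are known *)
  move: eq_prod; rewrite (bigD1 i) // [RHS](bigD1 i) //=.
  rewrite [\prod_(j | j != i) flow k2 j](eq_bigr (flow k1)); last first.
    move=> j ji; apply/esym/eq_flow_notin; apply: contra ji => jL.
    by apply/eqP/leak1.
  by apply: mulIf; apply/prodf_neq0 => j _; exact: flow1.
apply: eq_params => // i; have := eq_out i.
by rewrite /outflow eq_flow => /addrI.
Qed.

End CycleModel.

(** * Two leaks: the coefficient map is nowhere locally injective *)

(** Level sets of the product of two reals have no isolated point; at x = 0 one
    moves y, elsewhere one scales x by 1 + tau and y by its inverse. *)
Lemma perturb_product (R : realFieldType) (x y eta : R) : 0 < eta ->
  exists x' y', [/\ x' * y' = x * y, (x', y') != (x, y),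
    `|x - x'| < eta & `|y - y'| < eta].
Proof.
move=> eta0; have [->|x0] := eqVneq x 0.
  exists 0, (y + eta / 2); split.
  - by rewrite !mul0r.
  - by rewrite xpair_eqE eqxx /= -subr_eq0 addrC addKr; lra.
  - by rewrite subrr normr0.
  - by rewrite opprD addNKr normrN gtr0_norm; lra.
pose s := 1 + `|x| + `|y|; pose tau := eta / s.
have s0 : 0 < s by rewrite /s; have := normr_ge0 x; have := normr_ge0 y; lra.
have tau0 : 0 < tau by exact: divr_gt0.
have small (z : R) : `|z| < s -> `|z| * tau < eta.
  by move=> zs; rewrite /tau mulrCA gtr_pMr // ltr_pdivrMr // mul1r.
have t1 : 1 + tau != 0 by lra.
exists (x * (1 + tau)), (y / (1 + tau)); split.
- by field.
- rewrite xpair_eqE negb_and -[x in _ == x]mulr1.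
  by rewrite (inj_eq (mulfI x0)) -subr_eq0 addrC addKr gt_eqF.
- have -> : x - x * (1 + tau) = - (x * tau) by ring.
  rewrite normrN normrM (gtr0_norm tau0) small // /s.
  by have := normr_ge0 y; lra.
- have -> : y - y / (1 + tau) = y * tau / (1 + tau) by field.
  rewrite 2!normrM (gtr0_norm tau0) normfV (@gtr0_norm _ (1 + tau)); last by lra.
  apply: le_lt_trans (small y _).
    rewrite ler_pdivrMr; last by lra.
    by apply: ler_peMr; [exact: mulr_ge0 (normr_ge0 _) (ltW tau0)|rewrite lerDl ltW].
  by rewrite /s; have := normr_ge0 x; lra.
Qed.

Section CycleModelNotInjective.
Variables (R : realType) (n : nat) (M : compartmental_model n) (q : 'I_n).
Hypotheses (n_ge3 : (3 <= n)%N) (cycleM : cycle_model M).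
Hypotheses (inM : inputs M = [set q]%SET) (outM : outputs M = [set q]%SET).

(** The leaks at s and t absorb the change of the edge parameters, so all
    outflows and the product of the edge parameters stay the same. *)
Lemma not_locally_injective (k : params R M)
    (U : set 'rV[R]_(#|edges M| + #|leaks M|)) :
  (1 < #|leaks M|)%N -> open U -> U k -> ~ set_inj U (@Defs.coef_map R n M).
Proof.
move=> /card_gt1P[s [t [sL tL st]]] openU Uk injU.
have /nbhs_ballP[eta /= eta0 ballU] : nbhs k U by exact: open_nbhs_nbhs.
have [x' [y' [xy' ne xx' yy']]] := perturb_product (flow k s) (flow k t) eta0.
pose e i := if i == s then x' else if i == t then y' else flow k i.
pose l i := outflow k i - e i.
pose k' : params R M := params_of M e l.
have e_near i : `|flow k i - e i| < eta.
  rewrite /e; case: eqP => [-> //|_]; case: eqP => [-> //|_].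
  by rewrite subrr normr0.
have flow_k' i : flow k' i = e i by exact: flow_params_of.
have out_k' i : outflow k' i = outflow k i.
  rewrite /outflow flow_k' leak_params_of; case: ifPn => iL.
    by rewrite /l addrC subrK.
  rewrite leak_param_notin // /e; case: eqP => [is_|_]; first by rewrite is_ sL in iL.
  by case: eqP => // it; rewrite it tL in iL.
have Uk' : U k'.
  apply: ballU; split=> // c d; rewrite ord1 -[d]fintype.splitK.
  case: (fintype.split d) => r /=; rewrite -ball_normE /=.
    by rewrite -!(flow_enum_val cycleM) flow_k'.
  rewrite -!leak_param_enum_val leak_params_of enum_valP /l /outflow.
  rewrite -normrN; set j := enum_val r.
  suff -> : - (leak_param k j - (flow k j + leak_param k j - e j)) = flow k j - e j.
    exact: e_near.
  by ring.
have prod_k' : \prod_i flow k' i = \prod_i flow k i.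
  rewrite (bigD1 s) //= (bigD1 t) 1?eq_sym //= [RHS](bigD1 s) //= [in RHS](bigD1 t) 1?eq_sym //=.
  rewrite !flow_k' !mulrA /e !eqxx eq_sym (negbTE st) xy'; congr (_ * _).
  by apply: eq_bigr => i /andP[/negbTE is_ /negbTE it]; rewrite flow_k' /e is_ it.
have eq_kk' : k = k'.
  apply: injU; rewrite ?inE //; apply/(eq_coef_mapP n_ge3 cycleM inM outM).
  rewrite !(ioeq_lhs_cycle n_ge3 cycleM) !(ioeq_rhs_cycle _ n_ge3 cycleM) prod_k'.
  by split; [congr (_ - _)|]; apply: eq_bigr => i _; rewrite out_k'.
case/eqP: ne; rewrite [in RHS]eq_kk' !flow_k' /e !eqxx eq_sym.
by rewrite (negbTE st).
Qed.

End CycleModelNotInjective.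

(** * The characterization *)

Theorem theorem3p8 (R : realType) (n : nat) (M : compartmental_model n)
    (q : 'I_n) (hn : (3 <= n)%N) (hcycle : cycle_model M)
    (hin : inputs M = [set q]%SET) (hout : outputs M = [set q]%SET) :
  generically_locally_identifiable R M <-> (#|leaks M| <= 1)%N.
Proof.
split=> [[N nullN locally_inj]|leak1].
  rewrite leqNgt; apply/negP => leak2; apply: (@not_null_setT R (#|edges M| + #|leaks M|)).
  move=> eps /nullN[D [a [b [ab cover vol]]]]; exists D, a, b; split=> //.
  apply: subset_trans cover => k _; apply: contrapT => /locally_inj[U [openU Uk]].
  exact: (not_locally_injective hn hcycle hin hout leak2 openU Uk).
exists [set k | ~ generic q k]; first exact: null_not_generic.
move=> k /contrapT; exact: generic_locally_injective.
Qed.
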